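(* Let $T$ be a switch-tree and let $S$ be a convex point set in the plane such that $|S|=|T|$ (the number of points of $S$ equals the number of vertices of $T$). Then $T$ admits an upward planar straight-line embedding (UPSE) into $S$.
   Context: All graphs and point sets are finite and nonempty. A directed tree is a digraph whose underlying undirected graph is a tree; $(u,v)$ denotes an arc directed from $u$ to $v$. A switch-tree is a directed tree in which each vertex is either a source (no incoming arcs) or a sink (no outgoing arcs). A point set in the plane is convex (in convex position) if no point lies in the convex hull of the others; in addition, no two points of the set have the same $y$-coordinate. A UPSE of a digraph $D$ into a point set $S$ with $|S|=|V(D)|$ is a mapping of the vertices of $D$ to distinct points of $S$, and of each arc to the straight-line segment between the images of its end-vertices, such that no two arcs cross (two segments meet only at the image of a common end-vertex) and for each arc $(u,v)$ the image of $u$ has strictly smaller $y$-coordinate than the image of $v$. *)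

(* Defs.v *)
From mathcomp Require Import all_boot all_order all_algebra finmap.
From mathcomp Require Import interval_inference classical_sets reals convex.

Set Implicit Arguments.
Unset Strict Implicit.
Unset Printing Implicit Defensive.

Import Order.TTheory GRing.Theory Num.Theory.

Local Open Scope classical_set_scope.
Local Open Scope ring_scope.
Local Open Scope convex_scope.

(* A digraph is a relation [arc] on a finite type of vertices, [arc u v]
   meaning that [(u, v)] is an arc. *)
Section Digraphs.
Variable V : finType.
Implicit Types (e arc : rel V) (v : V).

(* Traversing an edge back and forth is a [ucycle] of size 2, hence the bound
   in the acyclicity clause. *)
Definition is_tree e : Prop :=
  [/\ symmetric e, irreflexive e, (0 < #|V|)%N,
      (forall x y, connect e x y)
    & (forall c : seq V, ucycle e c -> (size c <= 2)%N)].

Definition underlying arc : rel V := [rel u v | arc u v || arc v u].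

(* Opposite arcs would be parallel edges of the underlying undirected graph,
   which [underlying], being a relation, cannot detect. *)
Definition directed_tree arc : Prop :=
  is_tree (underlying arc) /\ forall u v, arc u v -> ~~ arc v u.

Definition source arc v : Prop := forall u, ~~ arc u v.

Definition sink arc v : Prop := forall u, ~~ arc v u.

Definition switch_tree arc : Prop :=
  directed_tree arc /\ forall v, source arc v \/ sink arc v.

End Digraphs.

Section Plane.
Variable R : realType.

Definition ycoord (p : 'rV[R]_2) : R := p 0 1.

Definition convex_hull (A : set 'rV[R]_2) : set 'rV[R]_2 :=
  smallest (@convex_set R 'rV[R]_2) A.

Definition segment (p q : 'rV[R]_2) : set 'rV[R]_2 :=
  range (fun t : {i01 R} =>
    (p : convex_lmodType 'rV[R]_2) <| t |> (q : convex_lmodType 'rV[R]_2)).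

Definition convex_point_set (S : {fset 'rV[R]_2}) : Prop :=
  (forall p, p \in S -> ~ convex_hull [set` (S `\ p)%fset] p)
  /\ {in S &, injective ycoord}.

Definition is_UPSE (V : finType) (arc : rel V) (S : {fset 'rV[R]_2})
    (f : V -> 'rV[R]_2) : Prop :=
  [/\ injective f,
      (forall v, f v \in S),
      (forall u v u' v', arc u v -> arc u' v' -> (u, v) <> (u', v') ->
         segment (f u) (f v) `&` segment (f u') (f v')
           `<=` f @` ([set u; v] `&` [set u'; v']))
    & (forall u v, arc u v -> ycoord (f u) < ycoord (f v))].

End Plane.

(* Main.v *)
Require Import Defs.
From mathcomp Require Import all_boot all_order all_algebra finmap.
From mathcomp Require Import interval_inference classical_sets reals convex.
From mathcomp Require Import zify ring lra.

(* List S cyclically, from the top point down the left chain to the bottom point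
   and up the right chain. In this order all triples are oriented alike, so
   segments cross only if their end-positions interleave, and the heights are
   strictly quasi-convex, so every interval of positions has its highest point at
   one of its two ends. It remains to place the vertices of the tree on the
   positions without interleaving edges. Delete an edge xy, with x a sink and y a
   source, and place the two components on consecutive intervals, the one of x at
   the end that carries the highest point. By induction x sits on that highest
   point, and y is not enclosed by an edge of its own component; so xy can be
   added, it goes upward, and y is still not enclosed. *)

Set Implicit Arguments.
Unset Strict Implicit.
Unset Printing Implicit Defensive.

Import Order.TTheory GRing.Theory Num.Theory.

Local Open Scope ring_scope.

(** * Deleting an edge of a forest *)

Section EdgeDeletion.
Variable V : finType.
Implicit Types (e : rel V) (x y z r c : V).

Definition acyclic e := forall c : seq V, ucycle e c -> (size c <= 2)%N.

Definition del_edge e x y : rel V :=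
  [rel u v | e u v && ~~ ((u == x) && (v == y) || (u == y) && (v == x))].

Definition component e x : {set V} := [set z | connect e x z].

Lemma del_edge_sub e x y : subrel (del_edge e x y) e.
Proof. by move=> u v /andP[]. Qed.

Lemma del_edge_sym e x y : symmetric e -> symmetric (del_edge e x y).
Proof.
move=> se u v; rewrite /del_edge /= se; congr (_ && ~~ _).
by rewrite orbC; congr (_ || _); rewrite andbC.
Qed.

Lemma acyclic_sub e e' : subrel e' e -> acyclic e -> acyclic e'.
Proof.
move=> sub ac c /andP[cyc uc]; apply: ac; apply/andP; split=> //.
exact: sub_cycle cyc.
Qed.

(** A path from [x] to [y] that avoids the edge can be made simple and closes up with [xy] to a
    cycle. The size bound leaves only the one-step path, which is the deleted edge itself. *)
Lemma acyclic_bridge e x y :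
  symmetric e -> irreflexive e -> acyclic e -> e x y ->
  ~~ connect (del_edge e x y) x y.
Proof.
move=> se ie ac exy; apply/negP => /connectP[p ep lp].
case: (shortenP ep) lp => p' ep' up' _ lp.
have : ucycle e (x :: p').
  rewrite /ucycle up' andbT /= rcons_path -lp se exy andbT.
  by apply: sub_path ep'; exact: del_edge_sub.
move/ac; case: p' ep' lp {up'} => [|z [|]] //=.
  by move=> _ yx; rewrite yx ie in exy.
by rewrite /del_edge /= => + yz; rewrite -yz !eqxx andbF.
Qed.

(** Induction along a path from [x]: a step over the deleted edge lands on [x] or [y], hence at the
    root of one of the two components, and any other step stays in its component. *)
Lemma component_del_edge e x y : symmetric e -> e x y ->
  component e x = component (del_edge e x y) x :|: component (del_edge e x y) y.
Proof.
move=> se exy; set e' := del_edge e x y.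
have sub u v : connect e' u v -> connect e u v.
  by apply: connect_sub => a b /del_edge_sub; exact: connect1.
apply/eqP; rewrite finset.eqEsubset; apply/andP; split; apply/fintype.subsetP => z; last first.
  rewrite !inE => /orP[/sub //|/sub]; exact: connect_trans (connect1 exy).
rewrite inE => /connectP[p]; elim/last_ind: p z => [|p z IH] w.
  by move=> _ ->; rewrite !inE connect0.
rewrite rcons_path last_rcons => /andP[/IH /(_ erefl)] + + ->.
rewrite !inE; set u := last x p => cu euz.
have [/orP[/andP[_ /eqP->]|/andP[_ /eqP->]]|nuz] :=
    boolP ((u == x) && (z == y) || (u == y) && (z == x)).
- by rewrite connect0 orbT.
- by rewrite connect0.
have e'uz : connect e' u z by apply: connect1; rewrite /e' /del_edge /= euz.
by case/orP: cu => /connect_trans/(_ e'uz) ->; rewrite ?orbT.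
Qed.

Lemma component_closed e r u v : e u v ->
  u \in component e r -> v \in component e r.
Proof. by move=> euv; rewrite !inE => /connect_trans; apply; exact: connect1. Qed.

End EdgeDeletion.

(** * Layouts on a line with quasi-convex heights *)

Section Layout.
Variables (R : realType) (h : nat -> R) (N : nat).
Hypothesis hinj : forall i j, (i < N)%N -> (j < N)%N -> h i = h j -> i = j.
Hypothesis hconv :
  forall i j k, (i < j < k)%N -> (k < N)%N -> (h j < h i) || (h j < h k).

(** The highest of the [n] positions from [m] on; by [hconv] only the two ends compete for it. *)
Definition top_end m n := if h (m + n).-1 < h m then m else (m + n).-1.

Lemma top_end_max m n i : (m + n <= N)%N -> (m <= i < m + n)%N ->
  i != top_end m n -> h i < h (top_end m n).
Proof.
move=> mnN imn; have [->|im] := eqVneq i m.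
  rewrite /top_end; case: ifPn; rewrite ?eqxx // -leNgt le_eqVlt.
  case/orP => // /eqP/hinj E; rewrite E ?eqxx //; lia.
have [->|imn'] := eqVneq i (m + n).-1.
  by rewrite /top_end; case: ifPn; rewrite ?eqxx.
move=> _; rewrite /top_end.
have /orP := @hconv m i (m + n).-1 ltac:(lia) ltac:(lia).
case: ifPn => [hlt|]; last rewrite -leNgt => hle; case=> // hi.
  exact: lt_trans hi hlt.
exact: lt_le_trans hi hle.
Qed.

Lemma top_end_unique m n i : (m + n <= N)%N -> (m <= i < m + n)%N ->
  (forall j, (m <= j < m + n)%N -> h j <= h i) -> top_end m n = i.
Proof.
move=> mnN imn imax; apply/eqP; rewrite eq_sym; apply/negP => /negP.
move/(top_end_max mnN imn); rewrite ltNge imax //.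
rewrite /top_end; case: ifP; lia.
Qed.

Variables (V : finType) (up : pred V).

(** Here [e] is meant to be symmetric: [up] marks the heads of arcs and so restores their direction,
    and the single pattern in [layout_planar], taken over all orientations of the two edges, covers
    every interleaving. *)
Record layout (e : rel V) (W : {set V}) (m : nat) (f : V -> nat) : Prop := {
  layout_inj : {in W &, injective f};
  layout_range : forall u, u \in W -> (m <= f u < m + #|W|)%N;
  layout_up : forall u v, u \in W -> v \in W -> e u v -> up v ->
    h (f u) < h (f v);
  layout_planar : forall u v w z, u \in W -> v \in W -> w \in W -> z \in W ->
    e u v -> e w z -> ~~ [&& f u < f w, f w < f v & f v < f z]%N }.

(* The invariant of the induction: a sink root occupies the highest position,
   and a source root can be reached from outside. *)
Definition rooted_layout e (W : {set V}) m r f :=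
  [/\ layout e W m f, (up r -> f r = top_end m #|W|)
    & forall u v, u \in W -> v \in W -> e u v -> ~~ (f u < f r < f v)%N].

(** One layout serves both roots, so the induction may continue from either end of the edge [xy].
    The layouts of [X] and [Y] are assumed for every offset because the order of the two intervals
    depends on where the highest point lies. *)
Lemma layout_join (e e' : rel V) (X Y : {set V}) x y m :
  [disjoint X & Y] -> x \in X -> y \in Y -> up x -> ~~ up y ->
  (forall u v, u \in X :|: Y -> v \in X :|: Y -> e u v ->
    [\/ [/\ u \in X, v \in X & e' u v], [/\ u \in Y, v \in Y & e' u v],
        u = x /\ v = y | u = y /\ v = x]) ->
  (forall m, (m + #|X| <= N)%N -> exists f, rooted_layout e' X m x f) ->
  (forall m, (m + #|Y| <= N)%N -> exists f, rooted_layout e' Y m y f) ->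
  (m + #|X :|: Y| <= N)%N ->
  exists f, rooted_layout e (X :|: Y) m x f /\ rooted_layout e (X :|: Y) m y f.
Proof.
move=> dXY xX yY upx upy edges LX LY.
have -> : #|X :|: Y| = (#|X| + #|Y|)%N.
  by rewrite cardsU (disjoint_setI0 dXY) cards0 subn0.
move=> mN.
have X0 : (0 < #|X|)%N by apply/card_gt0P; exists x.
have Y0 : (0 < #|Y|)%N by apply/card_gt0P; exists y.
pose t := top_end m (#|X| + #|Y|).
(* [X] takes the end of the joint interval at which [t] lies; then [t] is also the highest position
   of the interval of [X]. *)
have [mX [mY [ends tX]]] : exists mX mY,
    (mX = m /\ mY = m + #|X| /\ t = m \/
     mY = m /\ mX = m + #|Y| /\ t = (m + #|X| + #|Y|).-1)%N
    /\ top_end mX #|X| = t.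
  have tmax i : (m <= i < m + (#|X| + #|Y|))%N -> h i <= h t.
    move=> im; have [->//|it] := eqVneq i t.
    by apply/ltW/top_end_max.
  have [tm|tm] : t = m \/ t = (m + #|X| + #|Y|).-1.
    rewrite /t /top_end addnA; case: ifP; [by left|by right].
    exists m, (m + #|X|)%N; split; first by left.
    apply: top_end_unique; [lia|lia|] => j jm; apply: tmax; lia.
  exists (m + #|Y|)%N, m; split; first by right; lia.
  apply: top_end_unique; [lia|lia|] => j jm; apply: tmax; lia.
have [fX [[iX rX uX pX] topX _]] := LX mX ltac:(lia).
have [fY [[iY rY uY pY] _ visY]] := LY mY ltac:(lia).
move: (topX upx); rewrite tX => {topX} fXx.
have [f [fEX fEY]] : exists f : V -> nat,
    {in X, f =1 fX} /\ {in Y, f =1 fY}.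
  exists (fun z => if z \in X then fX z else fY z); split=> z zW; first by rewrite zW.
  case: ifPn => // zX.
  by move/disjoint_setI0/finset.setP/(_ z): dXY; rewrite !inE zX zW.
have fx : f x = t by rewrite fEX.
have rX' u : u \in X -> (mX <= f u < mX + #|X|)%N by move=> uu; rewrite fEX ?rX.
have rY' u : u \in Y -> (mY <= f u < mY + #|Y|)%N by move=> uu; rewrite fEY ?rY.
have rXY u : u \in X :|: Y -> (m <= f u < m + (#|X| + #|Y|))%N.
  by rewrite inE => /orP[/rX'|/rY']; lia.
have iXY : {in X :|: Y &, injective f}.
  move=> u v; rewrite !inE => /orP[uu|uu] /orP[vv|vv].
  - by rewrite !fEX //; exact: iX.
  - by have := rX' _ uu; have := rY' _ vv; move: ends; clear; lia.
  - by have := rX' _ vv; have := rY' _ uu; move: ends; clear; lia.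
  - by rewrite !fEY //; exact: iY.
have yx : f y != t.
  by have := rX' _ xX; have := rY' _ yY; rewrite fx; lia.
have visY' u v : u \in Y -> v \in Y -> e' u v -> ~~ (f u < f y < f v)%N.
  by move=> uu vv euv; rewrite !fEY //; exact: visY.
have L : layout e (X :|: Y) m f.
  split=> //.
  - move=> u; rewrite cardsU (disjoint_setI0 dXY) cards0 subn0; exact: rXY.
  - move=> u v uu vv /(edges _ _ uu vv)[[uX' vX' euv]|[uY' vY' euv]|[-> ->]|[-> ->]] upv.
    + by rewrite !fEX //; exact: uX.
    + by rewrite !fEY //; exact: uY.
    + by rewrite upv in upy.
    + by rewrite fx; apply: top_end_max => //; apply: rXY; rewrite inE yY orbT.
  - move=> u v w z uu vv ww zz /(edges _ _ uu vv) euv /(edges _ _ ww zz) ewz.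
    have := rX' _ xX; have := rY' _ yY; rewrite fx => ry rx.
    (* Edges of one component do not interleave by assumption, and edges of different components lie
       in disjoint intervals. The edge [xy] starts at the outer end [t] and so spans the interval of
       [X]; an edge of [Y] interleaving with it would enclose [y], against [visY']. *)
    case: euv => [[uX' vX' euv]|[uY' vY' euv]|[-> ->]|[-> ->]];
    case: ewz => [[wX' zX' ewz]|[wY' zY' ewz]|[-> ->]|[-> ->]];
    rewrite ?fx; apply/and3P => -[].
    + by rewrite !fEX // => p1 p2 p3; have := pX _ _ _ _ uX' vX' wX' zX' euv ewz; rewrite p1 p2 p3.
    + by have := rX' _ uX'; have := rX' _ vX'; have := rY' _ wY';
        have := rY' _ zY'; move: ends rx ry; clear; lia.
    + by have := rX' _ uX'; have := rX' _ vX'; move: ends rx ry; clear; lia.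
    + by have := rX' _ uX'; have := rX' _ vX'; move: ends rx ry; clear; lia.
    + by have := rY' _ uY'; have := rY' _ vY'; have := rX' _ wX';
        have := rX' _ zX'; move: ends rx ry; clear; lia.
    + by rewrite !fEY // => p1 p2 p3; have := pY _ _ _ _ uY' vY' wY' zY' euv ewz; rewrite p1 p2 p3.
    + by have := rY' _ uY'; have := rY' _ vY'; have := visY' _ _ uY' vY' euv; move: ends rx ry; clear; lia.
    + by have := rY' _ uY'; have := rY' _ vY'; have := visY' _ _ uY' vY' euv; move: ends rx ry; clear; lia.
    + by have := rX' _ wX'; have := rX' _ zX'; move: ends rx ry; clear; lia.
    + by have := rY' _ wY'; have := rY' _ zY'; have := visY' _ _ wY' zY' ewz; move: ends rx ry; clear; lia.
    + move: ends rx ry; clear; lia.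
    + move: ends rx ry; clear; lia.
    + by have := rX' _ wX'; have := rX' _ zX'; move: ends rx ry; clear; lia.
    + by have := rY' _ wY'; have := rY' _ zY'; have := visY' _ _ wY' zY' ewz; move: ends rx ry; clear; lia.
    + move: ends rx ry; clear; lia.
    + move: ends rx ry; clear; lia.
exists f; split; split=> //.
- by rewrite fx /t cardsU (disjoint_setI0 dXY) cards0 subn0.
- by move=> u v /rXY ru /rXY rv _; rewrite fx; lia.
- by rewrite (negbTE upy).
- move=> u v uu vv /(edges _ _ uu vv)[[uX' vX' euv]|[uY' vY' euv]|[-> ->]|[-> ->]].
  + by have := rX' _ uX'; have := rX' _ vX'; have := rY' _ yY;
      move: ends; clear; lia.
  + exact: visY'.
  + by move: yx; clear; lia.
  + by clear; lia.
Qed.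

(** Induction on the number of edges, counted as ordered pairs, with the root arbitrary: an edge
    [rc] at the root is deleted, and its two ends root the remaining components. *)
Lemma exists_layout (e : rel V) r m :
  symmetric e -> irreflexive e -> acyclic e ->
  (forall u v, e u v -> up u = ~~ up v) ->
  (m + #|component e r| <= N)%N ->
  exists f, rooted_layout e (component e r) m r f.
Proof.
have [k] := ubnP #|[set p | e p.1 p.2]|; elim: k e r m => // k IH e r m.
rewrite ltnS => card_e se ie ac bip mN.
have [c erc|isolated] := pickP (e r); last first.
  have comp1 : component e r = [set r].
    apply/finset.setP => z; rewrite !inE; apply/idP/eqP => [|->]; last exact: connect0.
    by case/connectP => -[|a p] //= /andP[]; rewrite isolated.
  rewrite comp1 cards1 in mN *; exists (fun=> m).
  split; [split| |]; rewrite ?cards1.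
  - by move=> u v /set1P-> /set1P->.
  - by move=> u _; lia.
  - by move=> u v /set1P-> /set1P->; rewrite ie.
  - by move=> u v w z _ _ _ _ _ _; lia.
  - by rewrite /top_end addn1; case: ifP.
  - by move=> u v _ _ _; lia.
set e' := del_edge e r c.
have se' : symmetric e' := del_edge_sym r c se.
have IH' x n : (n + #|component e' x| <= N)%N ->
    exists f, rooted_layout e' (component e' x) n x f.
  apply: IH => //.
  - apply: leq_trans card_e; apply: proper_card; apply/properP; split.
      by apply/fintype.subsetP => -[u v]; rewrite !inE => /del_edge_sub.
    by exists (r, c); rewrite !inE //= /e' /del_edge /= !eqxx andbF.
  - by move=> x'; apply/negP => /del_edge_sub; rewrite ie.
  - exact: acyclic_sub (@del_edge_sub _ e r c) ac.
  - by move=> u v /del_edge_sub; exact: bip.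
have cr : component e r = component e' r :|: component e' c.
  exact: component_del_edge.
have dis : [disjoint component e' r & component e' c].
  rewrite -finset.setI_eq0; apply/eqP/finset.setP => z; rewrite !inE; apply/negP => /andP[rz].
  rewrite (sym_connect_sym se') => zc.
  by have := acyclic_bridge se ie ac erc; rewrite (connect_trans rz zc).
have edges u v : u \in component e' r :|: component e' c -> e u v ->
    [\/ [/\ u \in component e' r, v \in component e' r & e' u v],
        [/\ u \in component e' c, v \in component e' c & e' u v],
        u = r /\ v = c | u = c /\ v = r].
  move=> ucr euv.
  have [/orP[/andP[/eqP-> /eqP->]|/andP[/eqP-> /eqP->]]|nuv] :=
    boolP ((u == r) && (v == c) || (u == c) && (v == r)).
  - by constructor 3.
  - by constructor 4.
  have e'uv : e' u v by rewrite /e' /del_edge /= euv.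
  move: ucr; rewrite finset.in_setU => /orP[uC|uC].
    by constructor 1; split=> //; exact: component_closed uC.
  by constructor 2; split=> //; exact: component_closed uC.
have self x : x \in component e' x by rewrite inE connect0.
(* In [layout_join] the sink end of the edge plays [x]: this is [r] in the first case and [c] in the
   second. *)
rewrite cr; rewrite cr in mN; have := bip _ _ erc; case: (boolP (up r)) => upr upc.
  have upc' : ~~ up c by rewrite -upc.
  have [f [f1 _]] := layout_join dis (self r) (self c) upr upc'
    (fun u v uu _ => edges u v uu) (IH' r) (IH' c) mN.
  by exists f.
have upc' : up c by move/esym/negbFE: upc.
rewrite disjoint_sym in dis; rewrite finset.setUC in mN *.
have edges' u v : u \in component e' c :|: component e' r ->
    v \in component e' c :|: component e' r -> e u v ->
    [\/ [/\ u \in component e' c, v \in component e' c & e' u v],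
        [/\ u \in component e' r, v \in component e' r & e' u v],
        u = c /\ v = r | u = r /\ v = c].
  rewrite finset.setUC => uu _ /(edges _ _ uu)[].
  - by constructor 2.
  - by constructor 1.
  - by constructor 4.
  - by constructor 3.
have [f [_ f2]] := layout_join dis (self c) (self r) upc' upr edges'
  (IH' c) (IH' r) mN.
by exists f.
Qed.

End Layout.

(** * Convex point sets *)

Section Geometry.
Variable R : realType.
Implicit Types (p q r x : 'rV[R]_2).

Definition xcoord p : R := p 0 0.

(* Positive iff [r] lies to the right of the line [pq] directed from [p] to [q]. *)
Definition orient p q r : R :=
  (xcoord r - xcoord p) * (ycoord q - ycoord p)
  - (xcoord q - xcoord p) * (ycoord r - ycoord p).

Lemma orient_cycle p q r : orient q r p = orient p q r.
Proof. rewrite /orient; ring. Qed.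

Lemma orient_swap p q r : orient q p r = - orient p q r.
Proof. rewrite /orient; ring. Qed.

Lemma plane_ext p q : xcoord p = xcoord q -> ycoord p = ycoord q -> p = q.
Proof.
move=> ex ey; apply/rowP => i.
have [->|->] : i = 0 \/ i = 1 by case: i => -[|[|//]] ?; [left|right]; apply: val_inj.
  exact: ex.
exact: ey.
Qed.

Lemma segmentP p q x : segment p q x -> exists t : R,
  [/\ 0 <= t <= 1, xcoord x = t * xcoord p + (1 - t) * xcoord q
    & ycoord x = t * ycoord p + (1 - t) * ycoord q].
Proof.
case=> t _ <-; exists t%:num; split; first by rewrite ge0 le1.
  by rewrite /xcoord !mxE.
by rewrite /ycoord !mxE.
Qed.

Lemma convex_setP (A : set 'rV[R]_2) p q x (t : R) :
  convex_set (A : set (convex_lmodType 'rV[R]_2)) -> A p -> A q -> 0 <= t <= 1 ->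
  xcoord x = t * xcoord p + (1 - t) * xcoord q ->
  ycoord x = t * ycoord p + (1 - t) * ycoord q -> A x.
Proof.
move=> cA Ap Aq /andP[t0 t1] ex ey.
have /set_mem := cA p q (Itv01 t0 t1) (mem_set Ap) (mem_set Aq).
congr A; apply: plane_ext.
  by rewrite ex /xcoord !mxE.
by rewrite ey /ycoord !mxE.
Qed.

(* The horizontal line through [q] meets the segment [pr] weakly on one side of
   [q] and the segment [p'r'] weakly on the other. *)
Lemma convex_between (A : set 'rV[R]_2) p r p' r' q :
  convex_set (A : set (convex_lmodType 'rV[R]_2)) ->
  A p -> A r -> A p' -> A r' ->
  ycoord p < ycoord q < ycoord r -> ycoord p' < ycoord q < ycoord r' ->
  0 <= orient p r q -> orient p' r' q <= 0 -> A q.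
Proof.
move=> cA Ap Ar Ap' Ar'.
(* [w] is the point of the segment [ab] at the height of [q]; its horizontal offset from [q] has the
   sign of [orient a b q]. Two such points enclose [q] on a horizontal line. *)
have cut a b : A a -> A b -> ycoord a < ycoord q < ycoord b ->
    exists w, [/\ A w, ycoord w = ycoord q
      & (xcoord q - xcoord w) * (ycoord b - ycoord a) = orient a b q].
  move=> Aa Ab /andP[aq qb].
  have d0 : ycoord b - ycoord a != 0 by rewrite subr_eq0 gt_eqF // (lt_trans aq).
  pose t := (ycoord b - ycoord q) / (ycoord b - ycoord a).
  pose w : 'rV[R]_2 := t *: a + (1 - t) *: b.
  have wx : xcoord w = t * xcoord a + (1 - t) * xcoord b by rewrite /xcoord !mxE.
  have wy : ycoord w = t * ycoord a + (1 - t) * ycoord b by rewrite /ycoord !mxE.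
  have t01 : 0 <= t <= 1.
    rewrite /t divr_ge0 ?ler_pdivrMr ?mul1r; lra.
  exists w; split.
  - exact: convex_setP cA Aa Ab t01 wx wy.
  - by rewrite wy /t; field.
  - by rewrite wx /orient /t; field.
move=> pqr pqr'.
have [w [Aw wy wx]] := cut _ _ Ap Ar pqr.
have [w' [Aw' wy' wx']] := cut _ _ Ap' Ar' pqr'.
rewrite -wx -wx' pmulr_lge0 ?pmulr_lle0 ?subr_gt0; last 2 first.
- by case/andP: pqr'; exact: lt_trans.
- by case/andP: pqr; exact: lt_trans.
rewrite subr_ge0 subr_le0 => wq qw'.
have [ww'|ww'] := eqVneq (xcoord w) (xcoord w').
  by rewrite (_ : q = w) //; apply: plane_ext; lra.
have lt_ww' : xcoord w < xcoord w' by rewrite lt_neqAle ww'; lra.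
have d0 : xcoord w' - xcoord w != 0 by rewrite subr_eq0 eq_sym.
apply: (@convex_setP A w w' q ((xcoord w' - xcoord q) / (xcoord w' - xcoord w))) => //.
- rewrite divr_ge0 ?ler_pdivrMr ?mul1r; lra.
- by field.
- by rewrite wy wy'; ring.
Qed.

(* The hypotheses on [orient] hold when [p, q] and [p', q'] are non-crossing
   chords of points in convex position. *)
Lemma segments_meet p q p' q' x : segment p q x -> segment p' q' x ->
  0 <= orient p q p' * orient p q q' ->
  [/\ orient p q p' = 0 & orient p q q' = 0] \/
  (orient p q p' = 0 /\ x = p') \/ (orient p q q' = 0 /\ x = q').
Proof.
move=> /segmentP[t [t01 xt yt]] /segmentP[s [/andP[s0 s1] xs ys]].
(* [orient p q] is affine along [p'q'] and vanishes at [x], which lies on the line [pq]. *)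
have : s * orient p q p' + (1 - s) * orient p q q' = 0.
  transitivity (orient p q x).
    by rewrite /orient xs ys; ring.
  by rewrite /orient xt yt; ring.
set a := orient p q p'; set b := orient p q q' => ab0 ab.
have [a0|a0] := eqVneq a 0; have [b0|b0] := eqVneq b 0; first by left.
- right; left; split => //.
  move: ab0; rewrite a0 mulr0 add0r => /eqP; rewrite mulf_eq0 (negbTE b0) orbF.
  move=> /eqP s1''; have s1' : s = 1 by lra.
  by apply: plane_ext; rewrite ?xs ?ys s1'; ring.
- right; right; split => //.
  move: ab0; rewrite b0 mulr0 addr0 => /eqP; rewrite mulf_eq0 (negbTE a0) orbF.
  move=> /eqP s0'.
  by apply: plane_ext; rewrite ?xs ?ys s0'; ring.
(* With [a] and [b] of the same strict sign, the relation multiplied by [a] is a convex combination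
   of two positive numbers, so it cannot vanish. *)
- have {}ab : 0 < a * b by rewrite lt_neqAle eq_sym mulf_neq0.
  have a2 : 0 < a ^+ 2 by rewrite exprn_even_gt0 //= a0.
  have : s * a ^+ 2 + (1 - s) * (a * b) = 0.
    by rewrite -[RHS](mulr0 a) -ab0; ring.
  have : 0 <= s * a ^+ 2 by rewrite mulr_ge0 // ltW.
  have : 0 <= (1 - s) * (a * b) by rewrite mulr_ge0 ?subr_ge0 // ltW.
  have [s12|s12] := lerP s (1/2) => h1 h2 h3; exfalso; nra.
Qed.

(** The four end points differ from [q] in height, so every convex set containing [S] without [q]
    contains them, and by [convex_between] also [q]. *)
Lemma convex_point_set_between (S : {fset 'rV[R]_2}) p r p' r' q :
  convex_point_set S -> p \in S -> r \in S -> p' \in S -> r' \in S -> q \in S ->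
  ycoord p < ycoord q < ycoord r -> ycoord p' < ycoord q < ycoord r' ->
  0 <= orient p r q -> orient p' r' q <= 0 -> False.
Proof.
move=> [cS _] pS rS pS' rS' qS pqr pqr' o o'; apply: (cS q qS) => A [cA SA].
have inA z : z \in S -> ycoord z != ycoord q -> A z.
  move=> zS zq; apply: SA => /=; rewrite in_fsetD1 zS andbT.
  by apply: contra_neq zq => ->.
case/andP: (pqr) => pq qr; case/andP: (pqr') => pq' qr'.
apply: (convex_between cA _ _ _ _ pqr pqr' o o'); apply: inA => //.
- by rewrite lt_eqF.
- by rewrite gt_eqF.
- by rewrite lt_eqF.
- by rewrite gt_eqF.
Qed.

Lemma ex_min_seq (T : eqType) (g : T -> R) (s : seq T) : s != [::] ->
  exists2 z, z \in s & {in s, forall w, g z <= g w}.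
Proof.
elim: s => // a s IH _; have [->|/IH[z zs zmin]] := eqVneq s [::].
  by exists a; rewrite ?mem_head // => w; rewrite inE => /eqP->.
have [az|za] := lerP (g a) (g z).
  exists a; rewrite ?mem_head // => w; rewrite inE => /orP[/eqP->//|/zmin].
  exact: le_trans.
exists z; rewrite ?inE ?zs ?orbT // => w; rewrite inE => /orP[/eqP->|/zmin//].
exact: ltW.
Qed.

(* [S] listed from the top down the left chain to the bottom and then up the
   right chain: the sort key is the height above the bottom, negated on the left
   chain (which includes both extreme points). *)
Lemma convex_point_set_order (S : {fset 'rV[R]_2}) :
  convex_point_set S -> S != fset0 ->
  exists s : nat -> 'rV[R]_2,
  [/\ forall i, (i < #|` S|)%N -> s i \in S,
      forall i j, (i < #|` S|)%N -> (j < #|` S|)%N ->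
        ycoord (s i) = ycoord (s j) -> i = j,
      forall i j k, (i < j < k)%N -> (k < #|` S|)%N ->
        (ycoord (s j) < ycoord (s i)) || (ycoord (s j) < ycoord (s k))
    & forall i j k, (i < j < k)%N -> (k < #|` S|)%N ->
        orient (s i) (s j) (s k) < 0].
Proof.
move=> cS; case/fset0Pn => p0 p0S; have [_ yinj] := cS.
have nz : enum_fset S != [::] by apply/eqP => S0; move: p0S; rewrite -[_ \in S]/(p0 \in enum_fset S) S0.
have [b bS bmin] := ex_min_seq (@ycoord R) nz.
have [t tS tmax'] := ex_min_seq (fun z => - ycoord z) nz.
have tmax z : z \in S -> ycoord z <= ycoord t by move/tmax'; rewrite lerN2.
pose left z := orient b t z <= 0.
pose key z := if left z then ycoord b - ycoord z else ycoord z - ycoord b.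
(* The sign of the key records the chain: a right-chain point with key at most 0 would have the
   height of [b], hence be [b], which counts as left. *)
have key_left z : z \in S -> (key z <= 0) = left z.
  move=> zS; rewrite /key; case: ifPn => lz; first by rewrite subr_le0 bmin.
  apply/negP => /(fun h => le_anti (introT andP (conj h _))).
  rewrite subr_ge0 bmin // => /(_ isT) zb; case/negP: lz.
  have -> : z = b by apply: yinj => //; lra.
  by rewrite /left /orient !subrr !(mul0r, mulr0) subrr.
have key_inj : {in S &, injective key}.
  move=> z w zS wS zw; have := key_left _ zS; have := key_left _ wS.
  rewrite -zw => -> lzw; apply: yinj => //; move: zw; rewrite /key lzw.
  by case: ifP => _; lra.
(* The diagonal [bt] also crosses the height of [z]. If [uw] did not leave [z] strictly on the side
   of its chain, [z] would be enclosed between the two segments. *)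
have side z u w : z \in S -> u \in S -> w \in S ->
    ycoord u < ycoord z < ycoord w ->
    if key z <= 0 then orient u w z < 0 else 0 < orient u w z.
  move=> zS uS wS uzw; rewrite key_left // /left.
  have bzt : ycoord b < ycoord z < ycoord t.
    by have := bmin _ uS; have := tmax _ wS; lra.
  case: ifPn => lz; rewrite ltNge; apply/negP => ori.
    exact: (convex_point_set_between cS uS wS bS tS zS uzw bzt ori lz).
  apply: (convex_point_set_between cS bS tS uS wS zS bzt uzw _ ori).
  by rewrite -ltNge in lz; exact: ltW.
pose r := relpre key <=%R.
have sS z : (z \in sort r (enum_fset S)) = (z \in S) by rewrite mem_sort.
have szS : size (sort r (enum_fset S)) = #|` S| by rewrite size_sort.
have inS i : (i < #|` S|)%N -> nth p0 (sort r (enum_fset S)) i \in S.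
  by move=> iS; rewrite -sS mem_nth // szS.
exists (nth p0 (sort r (enum_fset S))); set s := nth p0 _ in inS *.
have sinj i j : (i < #|` S|)%N -> (j < #|` S|)%N -> s i = s j -> i = j.
  move=> iS jS /eqP; rewrite nth_uniq ?szS ?sort_uniq ?fset_uniq //.
  by move/eqP.
have klt i j : (i < j)%N -> (j < #|` S|)%N -> key (s i) < key (s j).
  move=> ij jS; have iS := ltn_trans ij jS.
  rewrite lt_neqAle; apply/andP; split.
    apply/eqP => /key_inj /sinj E; move: ij; rewrite E ?ltnn //; exact: inS.
  have rtr : transitive r by move=> ? ? ?; exact: le_trans.
  have rtot : total r by move=> ? ?; exact: le_total.
  by apply: (sorted_ltn_nth rtr p0 (sort_sorted rtot _)); rewrite ?inE ?szS.
have keyE z : z \in S -> if key z <= 0 then key z = ycoord b - ycoord z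
    else key z = ycoord z - ycoord b.
  by move=> zS; rewrite key_left // /key; case: (left z).
split=> //.
- move=> i j iS jS /yinj E; apply: sinj => //; apply: E; exact: inS.
(* If [s j] is on the left chain, so is [s i], and it is higher; otherwise [s k] is on the right
   chain and higher. *)
- move=> i j k /andP[ij jk] kS; have jS := ltn_trans jk kS.
  have iS := ltn_trans ij jS.
  move: (klt _ _ ij jS) (klt _ _ jk kS).
  move: (keyE _ (inS _ iS)) (keyE _ (inS _ jS)) (keyE _ (inS _ kS)).
  case: ifPn; case: ifPn; case: ifPn; do ?rewrite -ltNge; move=> *; apply/orP;
    solve [left; lra | right; lra | exfalso; lra].
- move=> i j k /andP[ij jk] kS; have jS := ltn_trans jk kS.
  have iS := ltn_trans ij jS.
  have yne (x y : nat) : (x < y)%N -> (y < #|` S|)%N -> ycoord (s x) != ycoord (s y).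
    move=> xy yS; have xS := ltn_trans xy yS; apply/eqP => /yinj E.
    by move: xy; rewrite (sinj _ _ xS yS) ?ltnn //; apply: E; exact: inS.
  (* [side] is applied to whichever of the three points has the middle height; [orient_cycle] and
     [orient_swap] carry the sign over to the order [i], [j], [k]. *)
  have med (x y z : nat) : (x < #|` S|)%N -> (y < #|` S|)%N -> (z < #|` S|)%N ->
      ycoord (s y) < ycoord (s x) -> ycoord (s x) < ycoord (s z) ->
      if key (s x) <= 0 then orient (s y) (s z) (s x) < 0
      else 0 < orient (s y) (s z) (s x).
    move=> xS yS zS yx xz; apply: side; rewrite ?yx ?xz //; exact: inS.
  have iki := yne _ _ (ltn_trans ij jk) kS.
  have := keyE _ (inS _ iS); have := keyE _ (inS _ jS); have := keyE _ (inS _ kS).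
  have := klt _ _ ij jS; have := klt _ _ jk kS.
  have medj := med j k i jS kS iS; have medj' := med j i k jS iS kS.
  have medi := med i j k iS jS kS; have medk := med k j i kS jS iS.
  have [kj|kj] := lerP (key (s j)) 0 => kjk kij kk kj' ki.
    have ki0 : key (s i) <= 0 by lra.
    rewrite ki0 in ki medi; rewrite kj in medj medj'.
    have yij : ycoord (s j) < ycoord (s i) by lra.
    have [ykj|] := ltP (ycoord (s k)) (ycoord (s j)).
      by rewrite -orient_cycle -orient_cycle medj.
    rewrite le_eqVlt (negbTE (yne _ _ jk kS)) /= => yjk.
    move: kk medk; case: ifPn => kk0 kk medk; first by lra.
    have [yki|] := ltP (ycoord (s k)) (ycoord (s i)).
      by rewrite -oppr_gt0 -orient_swap medk.
    rewrite le_eqVlt (negbTE iki) /= => yik.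
    by rewrite -orient_cycle medi.
  have kk0 : (key (s k) <= 0) = false by apply/negbTE; rewrite -ltNge; lra.
  rewrite kk0 in kk medk; rewrite leNgt kj /= in medj medj'.
  have yjk : ycoord (s j) < ycoord (s k) by lra.
  have [yij|] := ltP (ycoord (s i)) (ycoord (s j)).
    by rewrite -oppr_gt0 -orient_cycle -orient_cycle -orient_swap medj'.
  rewrite le_eqVlt eq_sym (negbTE (yne _ _ ij jS)) /= => yji.
  move: ki medi; case: ifPn => ki0 ki medi; last by lra.
  have [yki|] := ltP (ycoord (s k)) (ycoord (s i)).
    by rewrite -oppr_gt0 -orient_swap medk.
  rewrite le_eqVlt (negbTE iki) /= => yik.
  by rewrite -orient_cycle medi.
Qed.

End Geometry.

(** * Chords of a cyclically ordered point sequence *)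

Section Chords.
Variables (R : realType) (s : nat -> 'rV[R]_2) (N : nat).
Hypothesis counterclockwise : forall i j k, (i < j < k)%N -> (k < N)%N ->
  orient (s i) (s j) (s k) < 0.

(** Putting [c] before [a] is a cyclic shift of the increasing triple and keeps the sign; putting it
    between [a] and [b] is a transposition and reverses it. *)
Lemma chord_sides a b c : (a < b)%N -> (b < N)%N -> (c < N)%N ->
  [\/ [/\ c = a \/ c = b & orient (s a) (s b) (s c) = 0],
      [/\ (a < c < b)%N & 0 < orient (s a) (s b) (s c)]
    | [/\ (c < a)%N || (b < c)%N & orient (s a) (s b) (s c) < 0]].
Proof.
move=> ab bN cN.
have [ca|ca|->] := ltngtP c a; last first.
- by constructor 1; split; [left|rewrite /orient; ring].
- have [cb|cb|->] := ltngtP c b.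
  + constructor 2; split; first lia.
    rewrite -oppr_lt0 -orient_swap -orient_cycle; apply: counterclockwise; lia.
  + constructor 3; split; [lia|apply: counterclockwise; lia].
  + by constructor 1; split; [right|rewrite /orient; ring].
- constructor 3; split; first lia.
  by rewrite -orient_cycle -orient_cycle; apply: counterclockwise; lia.
Qed.

Lemma orient_eq0 a b c : a != b -> (a < N)%N -> (b < N)%N -> (c < N)%N ->
  orient (s a) (s b) (s c) = 0 -> c = a \/ c = b.
Proof.
rewrite neq_ltn => /orP[ab|ba] aN bN cN o0.
  by have [[]//|[_]|[_]] := chord_sides ab bN cN; rewrite o0 ltxx.
have o0' : orient (s b) (s a) (s c) = 0 by rewrite orient_swap o0 oppr0.
by have [[[] ->]|[_]|[_]] := chord_sides ba aN cN; rewrite ?o0' ?ltxx //; [right|left].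
Qed.

(** The excluded patterns are exactly those with one of [c], [d] strictly between [a] and [b] and
    the other strictly outside. The conclusion is the hypothesis of [segments_meet]. *)
Lemma noncrossing_chords a b c d :
  (a < b)%N -> (b < N)%N -> (c < N)%N -> (d < N)%N ->
  ~~ [&& a < c, c < b & b < d]%N -> ~~ [&& a < d, d < b & b < c]%N ->
  ~~ [&& c < a, a < d & d < b]%N -> ~~ [&& d < a, a < c & c < b]%N ->
  0 <= orient (s a) (s b) (s c) * orient (s a) (s b) (s d).
Proof.
move=> ab bN cN dN n1 n2 n3 n4.
have [[_ ->]|[ci co]|[ci co]] := chord_sides ab bN cN; first by rewrite mul0r.
  have [[_ ->]|[_ od]|[di _]] := chord_sides ab bN dN; first by rewrite mulr0.
    by rewrite mulr_ge0 // ltW.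
  exfalso; lia.
have [[_ ->]|[di _]|[_ od]] := chord_sides ab bN dN; first by rewrite mulr0.
  exfalso; lia.
by rewrite mulr_le0 // ltW.
Qed.

End Chords.

(** * The upward embedding of a switch-tree *)

Theorem theorem2 (R : realType) (V : finType) (arc : rel V)
    (S : {fset 'rV[R]_2}) :
  switch_tree arc -> convex_point_set S -> #|` S|%fset = #|V| ->
  exists f : V -> 'rV[R]_2, is_UPSE arc S f.
Proof.
move=> [[[se ie V0 conn ac] anti] sw] cS cardS.
have [r _] : exists r : V, r \in V by apply/card_gt0P.
have S0 : S != fset0 by rewrite -cardfs_gt0 cardS.
have [s [sS sinj sconv sor]] := convex_point_set_order cS S0.
rewrite cardS in sS sinj sconv sor.
(* In a switch-tree a vertex with an incoming arc is a sink, so [up] holds at the head of each arc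
   and fails at its tail. *)
pose up v := [exists u, arc u v].
have up_arc u v : arc u v -> up v /\ ~~ up u.
  move=> uv; split; first by apply/existsP; exists u.
  case: (sw u) => [src|snk]; last by have := snk v; rewrite uv.
  by apply/existsP => -[w]; apply/negP; exact: src.
have bip u v : underlying arc u v -> up u = ~~ up v.
  by case/orP => /up_arc[-> /negbTE ->].
have compT : component (underlying arc) r = finset.setT.
  by apply/finset.setP => z; rewrite !finset.inE conn.
have [] := @exists_layout R (fun i => ycoord (s i)) #|V| sinj sconv V up
  (underlying arc) r 0 se ie ac bip.
  by rewrite compT finset.cardsT.
move=> g [[]]; rewrite compT finset.cardsT add0n => gI gR gU gP _ _.
have inT (v : V) : v \in finset.setT by rewrite finset.in_setT.
have gN v : (g v < #|V|)%N by have /andP[] := gR v (inT v).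
have ginj : injective g by move=> u v; exact: gI.
have finj : injective (s \o g).
  by move=> u v /= suv; apply/ginj/sinj => //; rewrite suv.
have ltg u v u' v' : underlying arc u v -> underlying arc u' v' ->
    (g u < g v)%N ->
    0 <= orient (s (g u)) (s (g v)) (s (g u')) *
         orient (s (g u)) (s (g v)) (s (g v')).
  move=> uv uv' guv; have vu' : underlying arc v' u' by rewrite se.
  by apply: (noncrossing_chords sor) => //; apply: gP.
have nog u v : underlying arc u v -> g u != g v.
  by move=> uv; apply/eqP => /ginj E; rewrite E ie in uv.
exists (s \o g); split=> //.
- by move=> v; exact: sS.
- move=> u v u' v' uv uv' neq x [/= xs xs'].
  have euv : underlying arc u v by rewrite /underlying /= uv.
  have euv' : underlying arc u' v' by rewrite /underlying /= uv'.
  have guv := nog _ _ euv.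
  have prod_ge0 : 0 <= orient (s (g u)) (s (g v)) (s (g u')) *
                       orient (s (g u)) (s (g v)) (s (g v')).
    move: guv; rewrite neq_ltn => /orP[|gvu]; first exact: ltg.
    (* Exchanging [u] and [v] negates both factors and leaves the product unchanged. *)
    rewrite -mulrNN -!orient_swap; apply: ltg => //; by rewrite se.
  have end_in z : orient (s (g u)) (s (g v)) (s (g z)) = 0 -> z = u \/ z = v.
    move=> z0; have := orient_eq0 sor guv (gN u) (gN v) (gN z) z0.
    by case=> /ginj; [left|right].
  (* If both [u'] and [v'] lie on the line of [u] and [v], each is one of these two vertices; this
     gives a loop, the same arc or opposite arcs, all excluded. Otherwise the meeting point is an
     end of the second segment on that line, hence a common end. *)
  case: (segments_meet xs xs' prod_ge0) => [[/end_in u'E /end_in v'E]|].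
    have irr w : ~~ arc w w by have := ie w; rewrite /underlying /= orbb => ->.
    exfalso; case: u'E v'E neq uv' => -> [] -> neq'.
    + by apply/negP; exact: irr.
    + by case: neq'.
    + by apply/negP; exact: anti.
    + by apply/negP; exact: irr.
  case=> -[/end_in zE ->].
    by exists u' => //=; split=> //; left.
  by exists v' => //=; split=> //; right.
- move=> u v uv /=; apply: gU => //; first by rewrite /underlying /= uv.
  by have [] := up_arc _ _ uv.
Qed.
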